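(* Let $G$ be a $2$-caterpillar with $n$ vertices. Then the burning number of $G$ satisfies $b(G)\leq \left\lceil\sqrt{n}\right\rceil$.
   Context: All graphs are finite, simple and undirected. Burning a graph $G$ proceeds in discrete rounds: in round $1$ one vertex is set on fire; in each subsequent round, first the fire spreads from every burning vertex to all its neighbours, and then one additional vertex may be set on fire. The burning number $b(G)$ is the minimum number of rounds after which all vertices are burning; equivalently, the least $k$ for which there are vertices $x_1,\dots,x_k$ such that every vertex of $G$ is at distance at most $k-i$ from $x_i$ for some $i$. For a positive integer $p$, a $p$-caterpillar is a tree $G$ in which every vertex is at distance at most $p$ from a central spine $P_l$, where $P_l$ is a longest path in $G$. *)

(* Defs.v *)
From HB Require Import structures.
From mathcomp Require Import all_boot all_order all_algebra.
From mathcomp Require Import reals.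

Set Implicit Arguments.
Unset Strict Implicit.
Unset Printing Implicit Defensive.

(* A finite simple graph is a finType T with a symmetric irreflexive relation
   e : rel T. *)

Section Trees.
Variables (T : finType) (e : rel T).

Definition connected_graph : Prop :=
  0 < #|T| /\ (forall x y : T, connect e x y).

(* For symmetric e, a duplicate-free e-cycle on two vertices is just an edge. *)
Definition acyclic_graph : Prop := forall c : seq T, ucycle e c -> size c <= 2.

Definition is_tree : Prop :=
  [/\ symmetric e, irreflexive e, connected_graph & acyclic_graph].

Definition dist_le (k : nat) (x y : T) : Prop :=
  exists s : seq T, [/\ path e x s, last x s = y & size s <= k].

Definition simple_path (P : seq T) : bool :=
  [&& P != [::], sorted e P & uniq P].

Definition longest_path (P : seq T) : Prop :=
  simple_path P /\ (forall Q : seq T, simple_path Q -> size Q <= size P).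

Definition caterpillar (p : nat) : Prop :=
  is_tree /\
  exists P : seq T, longest_path P /\
    (forall x : T, exists2 y, y \in P & dist_le p x y).

End Trees.

Section Burning.
Variables (T : finType) (e : rel T).

Definition spread (B : {set T}) : {set T} :=
  B :|: [set y | [exists x in B, e x y]].

(* ox = None: no additional vertex is set on fire in this round. *)
Definition burn_round (B : {set T}) (ox : option T) : {set T} :=
  if ox is Some x then x |: spread B else spread B.

Definition burned (s : seq (option T)) : {set T} := foldl burn_round set0 s.

(* The condition on ohead says that a vertex is set on fire in round 1. *)
Definition burnable (k : nat) : bool :=
  [exists s : k.-tuple (option T),
    (ohead s != Some None) && (burned s == [set: T])].

Lemma burnable_ex : exists k, burnable k.
Proof.
have sub_foldl (s : seq (option T)) (B : {set T}) : B \subset foldl burn_round B s.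
  elim: s B => [|ox s IHs] B //=; apply: subset_trans (IHs _).
  by case: ox => [x|]; apply/subsetP => y yB; rewrite !inE yB ?orbT.
exists (size (map Some (enum T))); apply/existsP.
exists (in_tuple (map Some (enum T))); apply/andP; split.
  by case: (enum T).
rewrite eqEsubset subsetT; apply/subsetP => x _ /=.
have: x \in enum T by rewrite mem_enum.
rewrite /burned; elim: (enum T) set0 => [|y s IHs] B //=.
rewrite inE => /predU1P[->|/IHs //].
by apply: (subsetP (sub_foldl _ _)); rewrite !inE eqxx.
Qed.

Definition burning_number : nat := ex_minn burnable_ex.

End Burning.

(* Main.v *)
Require Import Defs.
From mathcomp Require Import all_boot all_order all_algebra.
From mathcomp Require Import reals.
From mathcomp Require Import zify.

Set Implicit Arguments.
Unset Strict Implicit.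
Unset Printing Implicit Defensive.

Local Open Scope nat_scope.

(* Every vertex hangs at height at most 2 above a spine vertex.  Claim: for
   any set of distinct radii r1 > r2 > ..., balls with these radii cover any
   such graph with at most sum (2 r_i + 1) vertices; the radii 0, ..., k - 1
   give the bound k ^ 2.  Induct on the number of radii.  Let the ball of
   radius r1 eat a prefix of the spine.  If it eats fewer than 2 r1 + 1
   vertices, then all but at most one vertex of the prefix of length 2 r1 - 1
   lie on the spine itself, so a ball of radius r2 (or r3, if the exceptional
   vertex hangs exactly at the end of the r2-ball) eats a prefix without
   waste.  If r3 is needed but there are only two radii, put the r1-ball at the
   other end of the spine.  After a prefix is removed, the spine is rerouted
   through the hanging vertices at its new left end. *)

(** * Walks of bounded length *)

Section Distance.
Variables (T : finType) (e : rel T).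

Lemma dist_le_refl k x : dist_le e k x x.
Proof. by exists [::]. Qed.

Lemma dist_le_step k x y z : e x y -> dist_le e k y z -> dist_le e k.+1 x z.
Proof. by move=> exy [p [yp pz sp]]; exists (y :: p); rewrite /= exy. Qed.

Lemma dist_le_mono k m x y : k <= m -> dist_le e k x y -> dist_le e m x y.
Proof. by move=> km [p [xp py sp]]; exists p; split=> //; apply: leq_trans km. Qed.

Lemma dist_le_sym (sym_e : symmetric e) k x y :
  dist_le e k x y -> dist_le e k y x.
Proof.
case=> p [xp <- sp]; exists (rev (belast x p)).
rewrite rev_path size_rev size_belast; split=> //.
  by rewrite (eq_path (e' := e)) // => u v; rewrite sym_e.
by case: p xp sp => //= z p _ _; rewrite rev_cons last_rcons.
Qed.

End Distance.

(** * From covers by balls to burning sequences *)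

Section Burning.
Variables (T : finType) (e : rel T).

Lemma subset_foldl_burn_round (s : seq (option T)) (B : {set T}) :
  B \subset foldl (burn_round e) B s.
Proof.
elim: s B => [|ox s IHs] B //=; apply: subset_trans (IHs _).
by case: ox => [x|]; apply/subsetP => y yB; rewrite !inE yB ?orbT.
Qed.

Lemma burn_round_edge (B : {set T}) ox x y :
  x \in B -> e x y -> y \in burn_round e B ox.
Proof.
move=> xB exy; have yB : y \in spread e B.
  by rewrite !inE; apply/orP; right; apply/existsP; exists x; rewrite xB.
by case: ox => [z|] //=; rewrite in_setU yB orbT.
Qed.

Lemma foldl_burn_round_dist (s : seq (option T)) (B : {set T}) x y :
  x \in B -> dist_le e (size s) x y -> y \in foldl (burn_round e) B s.
Proof.
elim: s B x => [|ox s IHs] B x xB [p [xp lp sp]] /=.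
  by case: p xp lp sp => //= _ <-.
case: p xp lp sp => [|z p] /= => [_ <- _|/andP[exz zp] lp sp].
  apply: (subsetP (subset_foldl_burn_round s _)).
  by case: ox => [z|]; rewrite !inE xB ?orbT.
by apply: (IHs _ z); [apply: burn_round_edge exz | exists p].
Qed.

(** The centre depends on the radius alone, so each radius provides a single ball. Balls are taken
    in the whole graph: centres and walks may leave [X]. *)
Definition coverable (S : seq nat) (X : {set T}) : Prop :=
  exists c : nat -> T, forall x, x \in X ->
    exists2 r, r \in S & dist_le e r (c r) x.

Lemma coverable_burning_number k :
  coverable (rev (iota 0 k)) [set: T] -> burning_number e <= k.
Proof.
case=> c cP; rewrite /burning_number; case: ex_minnP => b _; apply.
have sz : size [seq Some (c r) | r <- rev (iota 0 k)] == k.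
  by rewrite size_map size_rev size_iota.
apply/existsP; exists (Tuple sz) => /=; apply/andP; split.
  by case: (rev _).
rewrite eqEsubset subsetT; apply/subsetP => x _.
have [r] := cP x (in_setT x); rewrite mem_rev mem_iota /= => rk dr.
(* After reversal the block [iota 0 r] comes last, so exactly [r] rounds follow the lighting of
   [c r]. *)
have -> : iota 0 k = iota 0 r ++ r :: iota r.+1 (k - r.+1).
  by rewrite [in LHS](_ : k = r + (k - r.+1).+1) ?iotaD //; lia.
rewrite rev_cat rev_cons map_cat map_rcons /burned foldl_cat foldl_rcons.
apply: (foldl_burn_round_dist (x := c r)); first by rewrite in_setU set11.
by rewrite size_map size_rev size_iota.
Qed.

End Burning.

(** * Half spines: counting, cutting and rerouting *)

Section Spine.
Variables (T : finType) (e : rel T).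
Hypothesis sym_e : symmetric e.

(* The spine is [s 0, ..., s L]; a vertex [x] hangs at height [g x] (at most 2)
   above the spine vertex [s (f x)].  Only the right end of the spine is
   required to be extremal. *)
Record half_spine (X : {set T}) (L : nat) (s : nat -> T) (f g : T -> nat) :
    Prop := HalfSpine {
  spine_in : forall i, i <= L -> s i \in X;
  spine_pos : forall i, i <= L -> f (s i) = i;
  spine_ht : forall i, i <= L -> g (s i) = 0;
  spine_edge : forall i, i < L -> e (s i) (s i.+1);
  spine_right : forall x, x \in X -> f x + g x <= L;
  spine_ht2 : forall x, x \in X -> g x <= 2;
  spine_fiber0 : forall x, x \in X -> g x = 0 -> x = s (f x);
  spine_fiber1 : forall x, x \in X -> g x = 1 -> e x (s (f x));
  spine_fiber2 : forall x, x \in X -> g x = 2 ->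
    exists y, [/\ y \in X, f y = f x, g y = 1 & e x y]
}.

Definition has_half_spine X L := exists s f g, half_spine X L s f g.

(** The second clause mirrors [spine_right] at the left end: no leg is longer than the piece of
    spine to the left of its foot. *)
Definition spine X L s f g :=
  half_spine X L s f g /\ forall x, x \in X -> g x <= f x.

(** One of the two truncated differences vanishes, so their sum is [|i - j|]. *)
Lemma dist_spine_spine X L s f g i j : half_spine X L s f g ->
  i <= L -> j <= L -> dist_le e ((i - j) + (j - i)) (s i) (s j).
Proof.
move=> H.
have fwd a d : a + d <= L -> dist_le e d (s a) (s (a + d)).
  elim: d a => [|d IHd] a ad; first by rewrite addn0; apply: dist_le_refl.
  apply: (dist_le_step (y := s a.+1)).
    by apply: (spine_edge H); lia.
  by rewrite -addSnnS; apply: IHd; lia.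
move=> iL jL; case: (leqP i j) => ij.
  have := fwd i (j - i); rewrite subnKC // => /(_ jL); apply: dist_le_mono; lia.
have := fwd j (i - j); rewrite subnKC; last lia.
by move=> /(_ iL) /(dist_le_sym sym_e); apply: dist_le_mono; lia.
Qed.

Lemma dist_spine X L s f g x i : half_spine X L s f g -> x \in X -> i <= L ->
  dist_le e ((f x - i) + (i - f x) + g x) (s i) x.
Proof.
move=> H xX iL; apply: (dist_le_sym sym_e).
have fL z : z \in X -> f z <= L by move=> /(spine_right H); lia.
have dS z : z \in X -> dist_le e ((f z - i) + (i - f z)) (s (f z)) (s i).
  by move=> zX; apply: (dist_spine_spine H) => //; apply: fL.
have := spine_ht2 H xX; case Eg: (g x) => [|[|[|n]]] // _.
- by rewrite {3}(spine_fiber0 H xX Eg) addn0; apply: dS.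
- by rewrite addn1; apply: dist_le_step (spine_fiber1 H xX Eg) (dS _ xX).
- have [y [yX fy gy exy]] := spine_fiber2 H xX Eg.
  rewrite addn2; apply: dist_le_step exy _.
  by apply: dist_le_step (spine_fiber1 H yX gy) _; rewrite -fy; apply: dS.
Qed.

(** The vertices of height 0 in the prefix are exactly [s 0], ..., [s (m - 1)]. *)
Lemma card_spine_prefix X L s f g m : half_spine X L s f g -> m <= L.+1 ->
  #|[set x in X | f x < m]| = m + #|[set x in X | (f x < m) && (0 < g x)]|.
Proof.
move=> H mL; rewrite -(cardsID [set x | g x == 0] [set x in X | f x < m]).
congr (_ + _); last first.
  apply: eq_card => x; rewrite !inE lt0n.
  by case: (g x == 0); rewrite ?andbF ?andbT //= andbC.
have -> : [set x in X | f x < m] :&: [set x | g x == 0] = [set s i | i : 'I_m].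
  apply/setP => x; rewrite !inE; apply/idP/imsetP => [|[i _ ->]].
    case/andP => /andP[xX fm] /eqP g0; exists (Ordinal fm) => //=.
    exact: (spine_fiber0 H).
  have iL : i <= L by have := ltn_ord i; lia.
  by rewrite (spine_in H) // (spine_pos H) // (spine_ht H) ?ltn_ord.
rewrite card_imset ?card_ord // => i j ij; apply: val_inj => /=.
have iL : i <= L by have := ltn_ord i; lia.
have jL : j <= L by have := ltn_ord j; lia.
by rewrite -(spine_pos H iL) ij (spine_pos H jL).
Qed.

Lemma half_spine_ltn_card X L : has_half_spine X L -> L < #|X|.
Proof.
case=> s [f [g H]]; have := card_spine_prefix H (leqnn L.+1).
have/subset_leq_card : [set x in X | f x < L.+1] \subset X.
  by apply/subsetP => x; rewrite inE => /andP[].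
by lia.
Qed.

(** Legs are removed together with their feet, so the right end is untouched. The left bound may
    fail, whence the weaker notion of half spine. *)
Lemma half_spine_suffix X L s f g m : half_spine X L s f g -> m <= L ->
  has_half_spine [set x in X | m <= f x] (L - m).
Proof.
move=> H mL; exists (fun i => s (i + m)), (fun x => f x - m), g; split.
- by move=> i iL; rewrite !inE (spine_in H) ?(spine_pos H); lia.
- by move=> i iL; rewrite (spine_pos H); lia.
- by move=> i iL; rewrite (spine_ht H); lia.
- by move=> i iL; apply: (spine_edge H); lia.
- by move=> x; rewrite inE => /andP[/(spine_right H)]; lia.
- by move=> x; rewrite inE => /andP[/(spine_ht2 H)].
- move=> x; rewrite inE => /andP[xX mf] g0; rewrite subnK //.
  exact: (spine_fiber0 H).
- move=> x; rewrite inE => /andP[xX mf] g0; rewrite subnK //.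
  exact: (spine_fiber1 H).
- move=> x; rewrite inE => /andP[xX mf] g2.
  have [y [yX fy gy exy]] := spine_fiber2 H xX g2.
  by exists y; rewrite inE yX fy mf.
Qed.

(** Some vertex [y] hangs at height 1 above [s 0]; it becomes the new left end. *)
Lemma half_spine_prepend X L s f g x : half_spine X L s f g -> x \in X ->
  f x = 0 -> 0 < g x -> has_half_spine X L.+1.
Proof.
move=> H xX fx gx.
have [y [yX fy gy]] : exists y, [/\ y \in X, f y = 0 & g y = 1].
  have := spine_ht2 H xX; case Eg: (g x) gx => [|[|[|n]]] // _ _.
    by exists x.
  by have [y [yX fy gy _]] := spine_fiber2 H xX Eg; exists y; rewrite fy.
have ey := spine_fiber1 H yX gy; rewrite fy in ey.
(* These vertices rest on [y], so they drop to height 1 above the new position 0; every other vertex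
   keeps its height and moves one place to the right. *)
pose onleg z := [&& g z == 2, f z == 0 & e z y].
pose f' z := if z == y then 0 else if onleg z then 0 else (f z).+1.
pose g' z := if z == y then 0 else if onleg z then 1 else g z.
exists (fun i => if i is i'.+1 then s i' else y), f', g'.
have sy i : i <= L -> (s i == y) = false.
  by move=> iL; apply/eqP => siy; move: gy; rewrite -siy (spine_ht H).
have so i : i <= L -> onleg (s i) = false.
  by move=> iL; rewrite /onleg (spine_ht H).
split.
- by case=> [|i] iL //; apply: (spine_in H).
- by case=> [|i] iL; rewrite /f' ?eqxx // sy // so // (spine_pos H).
- by case=> [|i] iL; rewrite /g' ?eqxx // sy // so // (spine_ht H).
- by case=> [|i] iL //; apply: (spine_edge H).
- move=> z zX; rewrite /f' /g'; have := spine_right H zX.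
  by case: (z == y); case: (onleg z); lia.
- move=> z zX; rewrite /f' /g'; have := spine_ht2 H zX.
  by case: (z == y); case: (onleg z); lia.
- move=> z zX; rewrite /f' /g'; case: eqP => // _; case: (onleg z) => //.
  exact: (spine_fiber0 H).
- move=> z zX; rewrite /f' /g'; case: eqP => // _; case E: (onleg z).
    by case/and3P: E.
  exact: (spine_fiber1 H).
- move=> z zX; rewrite /f' /g'; case: eqP => // _; case E: (onleg z) => // gz.
  have [w [wX fw gw ezw]] := spine_fiber2 H zX gz; exists w.
  have wy : (w == y) = false.
    apply/eqP => wy; subst w; move: E; rewrite /onleg gz -fw fy ezw //.
  by rewrite wy /onleg gw /= fw.
Qed.

(** The vertex [y] below [x] trades places with [s 0], which then hangs at height 1 above [s 1]. The
    length is unchanged, but [x] now hangs above the left end, as [half_spine_prepend] requires. As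
    nothing hangs above [s 0], no leg becomes longer than 2. *)
Lemma half_spine_swap X L s f g x : half_spine X L s f g -> x \in X ->
  f x = 1 -> g x = 2 -> (forall z, z \in X -> f z = 0 -> g z = 0) ->
  exists s' f' g', half_spine X L s' f' g' /\ (f' x = 0 /\ 0 < g' x).
Proof.
move=> H xX fx gx clean.
have [y [yX fy gy exy]] := spine_fiber2 H xX gx.
rewrite fx in fy.
have ey := spine_fiber1 H yX gy; rewrite fy in ey.
have L3 : 3 <= L by have := spine_right H xX; lia.
pose onleg z := [&& g z == 2, f z == 1 & e z y].
pose f' z := if z == y then 0 else if z == s 0 then 1 else
  if onleg z then 0 else f z.
pose g' z := if z == y then 0 else if z == s 0 then 1 else
  if onleg z then 1 else g z.
exists (fun i => if i is 0 then y else s i), f', g'.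
have sy i : i <= L -> (s i == y) = false.
  by move=> iL; apply/eqP => siy; move: gy; rewrite -siy (spine_ht H).
have so i : i <= L -> onleg (s i) = false.
  by move=> iL; rewrite /onleg (spine_ht H).
have s0 i : i < L -> (s i.+1 == s 0) = false.
  move=> iL; apply/eqP => E; have := spine_pos H iL.
  by rewrite E (spine_pos H).
split; last first.
  rewrite /f' /g'; case: eqP => [E|_]; first by move: gx; rewrite E gy.
  case: eqP => [E|_]; first by move: gx; rewrite E (spine_ht H).
  by rewrite /onleg gx fx exy.
split.
- by case=> [|i] iL //; apply: (spine_in H).
- by case=> [|i] iL; rewrite /f' ?eqxx // sy // s0 // so // (spine_pos H).
- by case=> [|i] iL; rewrite /g' ?eqxx // sy // s0 // so // (spine_ht H).
- by case=> [|i] iL //; apply: (spine_edge H).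
- move=> z zX; rewrite /f' /g'; have := spine_right H zX.
  by case: (z == y); case: (z == s 0); case: (onleg z); lia.
- move=> z zX; rewrite /f' /g'; have := spine_ht2 H zX.
  by case: (z == y); case: (z == s 0); case: (onleg z); lia.
- move=> z zX; rewrite /f' /g'; case: eqP => // _; case: eqP => // z0.
  case: (onleg z) => // gz; have E := spine_fiber0 H zX gz.
  by rewrite {1}E; case fz: (f z) E => // E; case: z0.
- move=> z zX; rewrite /f' /g'; case: eqP => // _; case: eqP => [-> _|_].
    by apply: (spine_edge H); lia.
  case E: (onleg z); first by case/and3P: E.
  move=> gz; have := spine_fiber1 H zX gz.
  by case fz: (f z) => //; move: gz; rewrite clean.
- move=> z zX; rewrite /f' /g'; case: eqP => // _; case: eqP => // _.
  case E: (onleg z) => // gz.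
  have [w [wX fw gw ezw]] := spine_fiber2 H zX gz; exists w.
  have -> : (w == y) = false.
    by apply/eqP => wy; subst w; move: E; rewrite /onleg gz -fw fy ezw.
  have -> : (w == s 0) = false.
    by apply/eqP => w0; move: gw; rewrite w0 (spine_ht H).
  by rewrite /onleg gw /= fw.
Qed.

(* A half spine of maximal length is extremal at its left end too. *)
Lemma spine_of_half_spine X L : has_half_spine X L ->
  exists L' s f g, spine X L' s f g.
Proof.
(* Each rerouting lengthens the spine while [L < #|X|], so [#|X| - L] decreases. *)
move: {2}(#|X| - L) (leqnn (#|X| - L)) => n; elim: n L => [|n IHn] L nL hL.
  by have := half_spine_ltn_card hL; lia.
have grow : has_half_spine X L.+1 -> exists L' s f g, spine X L' s f g.
  by apply: IHn; have := half_spine_ltn_card hL; lia.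
case: (hL) => s [f [g H]].
(* Heights are at most 2, so [g x <= f x] can fail only above position 0, or at height 2 above
   position 1; either failure lets the spine grow. *)
have [|clean] := boolP [exists x in X, (f x == 0) && (0 < g x)].
  case/exists_inP => x xX /andP[/eqP fx gx].
  exact: grow (half_spine_prepend H xX fx gx).
have {}clean z : z \in X -> f z = 0 -> g z = 0.
  move=> zX fz; apply/eqP; rewrite -leqn0 leqNgt; apply: contra clean => gz.
  by apply/exists_inP; exists z; rewrite ?fz.
have [|tight] := boolP [exists x in X, (f x == 1) && (g x == 2)].
  case/exists_inP => x xX /andP[/eqP fx /eqP gx].
  have [s' [f' [g' [H' [fx' gx']]]]] := half_spine_swap H xX fx gx clean.
  exact: grow (half_spine_prepend H' xX fx' gx').
exists L, s, f, g; split=> // x xX; rewrite leqNgt; apply: contra tight => fg.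
apply/exists_inP; exists x => //; have := spine_ht2 H xX.
by case: (f x) fg (clean x xX) => [|n']; lia.
Qed.


(** * Covering spines by balls of distinct radii *)

Lemma coverable_cons (X Y : {set T}) (S : seq nat) r (c : T) : r \notin S ->
    (forall x, x \in X -> x \notin Y -> dist_le e r c x) ->
  coverable e S Y -> coverable e (r :: S) X.
Proof.
move=> rS near [d dP]; exists (fun k => if k == r then c else d k) => x xX.
have [xY|xY] := boolP (x \in Y).
  have [k kS dk] := dP x xY; exists k; first by rewrite inE kS orbT.
  by case: eqP => // E; rewrite -E kS in rS.
by exists r; rewrite ?mem_head // eqxx; apply: near.
Qed.

Lemma eq_coverable (S S' : seq nat) X : S =i S' -> coverable e S X -> coverable e S' X.
Proof.
move=> E [c cP]; exists c => x /cP[r rS dr]; exists r => //; by rewrite -E.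
Qed.

(** Left of the centre [s r] the bound [g x <= f x] keeps [x] within [r]; right of it the bound on
    [f x + g x] does. *)
Lemma dist_spine_left X L s f g r x : spine X L s f g -> r <= L ->
  x \in X -> f x + g x <= r.*2 -> dist_le e r (s r) x.
Proof.
case=> H left rL xX fgx; apply: dist_le_mono (dist_spine H xX rL).
by have := left x xX; lia.
Qed.

(** Both ends are extremal, so one ball suffices; its centre moves to the last spine vertex when
    [L < r]. *)
Lemma coverable_short_spine X L s f g r S : spine X L s f g -> L <= r.*2 ->
  coverable e (r :: S) X.
Proof.
case=> H left Lr; exists (fun=> s (minn r L)) => x xX.
exists r; rewrite ?mem_head //.
apply: dist_le_mono (dist_spine H xX (geq_minr r L)).
by have := left x xX; have := spine_right H xX; lia.
Qed.

(** The ball around [s r] swallows the prefix of length [m], which has at least [2 r + 1] vertices,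
    so the rest fits the budget of [S]. The list [r :: S] need not be sorted: any radius may be
    brought to the front. *)
Lemma coverable_cut X L s f g r m (S : seq nat) : spine X L s f g -> r \notin S ->
    r.*2 <= L -> m <= L ->
    (forall x, x \in X -> f x < m -> f x + g x <= r.*2) ->
    r.*2 < m + #|[set x in X | (f x < m) && (0 < g x)]| ->
    #|X| <= \sum_(i <- r :: S) i.*2.+1 ->
    (forall Y, (exists L' s' f' g', spine Y L' s' f' g') ->
       #|Y| <= \sum_(i <- S) i.*2.+1 -> coverable e S Y) ->
  coverable e (r :: S) X.
Proof.
move=> H rS rL mL near cardm; rewrite big_cons => cardX IH.
apply: (coverable_cons (c := s r) (Y := [set x in X | m <= f x])) => // [x xX|].
  rewrite inE xX /= -ltnNge => fm.
  by apply: (dist_spine_left H); [lia | | exact: near].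
apply: IH; first exact: spine_of_half_spine (half_spine_suffix H.1 mL).
have := card_spine_prefix H.1 (leqW mL).
have := cardsID [set x | f x < m] X.
rewrite -(_ : [set x in X | f x < m] = X :&: [set x | f x < m]); last first.
  by apply/setP => x; rewrite !inE.
rewrite -(_ : [set x in X | m <= f x] = X :\: [set x | f x < m]); last first.
  by apply/setP => x; rewrite !inE -leqNgt andbC.
by move: (\sum_(i <- S) _) cardX => N; lia.
Qed.

Lemma coverable_spine S X L s f g : sorted gtn S -> spine X L s f g ->
  #|X| <= \sum_(r <- S) r.*2.+1 -> coverable e S X.
Proof.
(* The induction is on the length of [S], because the radius spent need not be the head. *)
move: {2}(size S) (erefl (size S)) => n.
elim: n S X L s f g => [|n IHn] [|r1 S] // X L s f g.
  move=> _ _ H; rewrite big_nil.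
  have : L < #|X| by apply: half_spine_ltn_card; exists s, f, g; exact: H.1.
  by lia.
move=> [szS] srt H cardX.
have hL : L < #|X| by apply: half_spine_ltn_card; exists s, f, g; exact: H.1.
have [Lr1|Lr1] := leqP L r1.*2; first exact: coverable_short_spine H Lr1.
have IH S' : size S' = n -> sorted gtn S' ->
    forall Y, (exists L' s' f' g', spine Y L' s' f' g') ->
    #|Y| <= \sum_(i <- S') i.*2.+1 -> coverable e S' Y.
  by move=> sz sS' Y [L' [s' [f' [g' H']]]]; apply: IHn H'.
case: S szS srt cardX => [|r2 S] szS srt cardX.
  by move: cardX; rewrite big_seq1; lia.
have /= /andP[r21 srtS] := srt.
have all2 : all (gtn r2) S.
  by rewrite (order_path_min _ srtS) // => a b c /=; lia.
have r2S : r2 \notin r1 :: S.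
  rewrite inE negb_or; apply/andP; split; first by apply/eqP; move: r21 => /=; lia.
  by apply/negP => /(allP all2) /=; lia.
have r1S : r1 \notin r2 :: S.
  rewrite inE negb_or; apply/andP; split; first by apply/eqP; move: r21 => /=; lia.
  by apply/negP => /(allP all2) /=; move: r21 => /=; lia.
have cut1 m : r1.*2.-1 <= m <= r1.*2.+1 ->
    (forall x, x \in X -> f x < m -> f x + g x <= r1.*2) ->
    r1.*2 < m + #|[set x in X | (f x < m) && (0 < g x)]| ->
    coverable e [:: r1, r2 & S] X.
  move=> /andP[m1 m2] near cardm.
  apply: (coverable_cut H) near cardm _ _ => //; try lia.
  exact: IH.
(* The [2 r2 + 1] spine vertices of this prefix already use up the budget of [r2]. *)
have cut2 : (forall x, x \in X -> f x < r2.*2.+1 -> f x + g x <= r2.*2) ->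
    coverable e [:: r1, r2 & S] X.
  move=> near; apply: (@eq_coverable [:: r2, r1 & S]).
    by move=> z; rewrite !inE orbCA.
  move: r21 => /= r21.
  apply: (coverable_cut H) near _ _ _ => //; try lia.
    by move: cardX; rewrite !big_cons addnCA.
  apply: IH => //=; case: (S) srtS => //= r3 S3 /andP[r32 ->]; rewrite andbT; lia.
move: r21 => /= r21.
have [|/forall_inPn[xe xeX]] :=
  boolP [forall x in X, (f x < r1.*2.+1) ==> (f x + g x <= r1.*2)].
  move/forall_inP => near; apply: (cut1 r1.*2.+1); [lia | | lia].
  by move=> x xX; apply/implyP; exact: near.
rewrite negb_imply -ltnNge => /andP[fxe gxe].
have [|/forall_inPn[xb xbX]] :=
  boolP [forall x in X, (f x < r1.*2) ==> (f x + g x <= r1.*2)].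
  move/forall_inP => near.
  case E: #|[set x in X | (f x < r1.*2) && (0 < g x)]| => [|k]; last first.
    apply: (cut1 r1.*2); [lia | | by rewrite E; lia].
    by move=> x xX; apply/implyP; exact: near.
  apply: cut2 => x xX fx; move/eqP: E; rewrite cards_eq0 => /eqP/setP/(_ x).
  by rewrite !inE xX /=; lia.
rewrite negb_imply -ltnNge => /andP[fxb gxb].
(* Now [xb] must have height 2 above position [2 r1 - 1]. *)
have gxb2 := spine_ht2 H.1 xbX.
have near x : x \in X -> f x < r1.*2.-1 -> f x + g x <= r1.*2.
  by move=> xX; have := spine_ht2 H.1 xX; lia.
(* Two hanging vertices make up for the two missing spine vertices of this shorter prefix; with
   none, [cut2] applies. *)
case E: #|[set x in X | (f x < r1.*2.-1) && (0 < g x)]| => [|[|k]]; last first.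
- by apply: (cut1 r1.*2.-1) => //; [lia | rewrite E; lia].
- move/eqP/cards1P: E => [w /setP Ew].
  have [wX fw gw] : [/\ w \in X, f w < r1.*2.-1 & 0 < g w].
    by have := Ew w; rewrite !inE eqxx => /and3P.
  have g0 x : x \in X -> f x < r1.*2.-1 -> x != w -> g x = 0.
    move=> xX fx xw; have := Ew x; rewrite !inE xX fx (negbTE xw) /=; lia.
  (* At height 2, [w] would rest on a second hanging vertex of the same prefix. *)
  have gw1 : g w = 1.
    have := spine_ht2 H.1 wX; case gw2 : (g w) gw => [|[|[|]]] // _ _.
    have [y [yX fy gy _]] := spine_fiber2 H.1 wX gw2.
    have := Ew y; rewrite !inE yX fy gy fw /= => /esym/eqP yw.
    by move: gy; rewrite yw gw2.
  have [fw2|fw2] := eqVneq (f w) r2.*2; last first.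
    apply: cut2 => x xX fx; have [xw|xw] := eqVneq x w; last by rewrite g0 //; lia.
    by move: fx; rewrite xw; lia.
  case: S szS srtS all2 {cut1 cut2 srt r2S} r1S cardX
    => [|r3 S] szS srtS all2 r1S cardX.
    have cardp := card_spine_prefix H.1 (leqnn L.+1).
    have cardL : #|[set x in X | f x < L.+1]| <= #|X|.
      by apply/subset_leq_card/subsetP => x; rewrite inE => /andP[].
    (* Both [w] and [xb] hang, so [L + 3 <= #|X|] and hence [L <= 2 r1 + 2 r2 - 1]. *)
    have card2 : 2 <= #|[set x in X | (f x < L.+1) && (0 < g x)]|.
      have wb : w != xb by apply/eqP => wb; move: fw; rewrite wb; lia.
      have <- : #|[set w; xb]| = 2 by rewrite cards2 wb.
      apply/subset_leq_card/subsetP => x.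
      by rewrite !inE => /orP[]/eqP->; rewrite ?wX ?xbX /=; lia.
    move: cardX; rewrite !big_cons big_nil => cardX.
    (* The large ball ends exactly at the right end of the spine. What it misses lies on the spine
       at positions below [2 r2]; in particular [w] is not missed. *)
    exists (fun r => if r == r1 then s (L - r1) else s r2) => x xX.
    have [far|close] := leqP (L - r1.*2 + g x) (f x).
      exists r1; rewrite ?mem_head // eqxx.
      apply: dist_le_mono (dist_spine H.1 xX (leq_subr r1 L)).
      by have := spine_right H.1 xX; lia.
    have xw : x != w by apply/eqP => xw; move: close; rewrite xw; lia.
    have gx2 := spine_ht2 H.1 xX.
    exists r2; first by rewrite !inE eqxx orbT.
    case: eqP => [|_]; first lia.
    have fx : f x < r1.*2.-1 by lia.
    by apply: (dist_spine_left H) => //; [lia | move: (g0 x xX fx xw) => ->; lia].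
  have /= /andP[r32 srtS3] := srtS.
  have all3 : all (gtn r3) S.
    by rewrite (order_path_min _ srtS3) // => a b c /=; lia.
  apply: (@eq_coverable [:: r3, r1, r2 & S]).
    by move=> z; rewrite !inE orbCA; congr (_ || _); rewrite orbCA.
  (* As [2 r3 + 1 < 2 r2 = f w], the prefix eaten by the ball of radius [r3] consists of spine
     vertices only. *)
  apply: (coverable_cut H (m := r3.*2.+1)) => //; try lia.
  - rewrite !inE !negb_or; apply/and3P; split; [apply/eqP; lia | apply/eqP; lia |].
    by apply/negP => /(allP all3) /=; lia.
  - move=> x xX fx; have xw : x != w by apply/eqP => xw; move: fx; rewrite xw; lia.
    by rewrite g0 //; lia.
  - by move: cardX; rewrite !big_cons (addnCA r3.*2.+1) (addnCA r3.*2.+1).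
  - apply: IH => //=; rewrite r21 /=; case: (S) srtS3 => //= r4 S4 /andP[r43 ->].
    by rewrite andbT; lia.
- apply: cut2 => x xX fx; move/eqP: E; rewrite cards_eq0 => /eqP/setP/(_ x).
  by rewrite !inE xX /=; lia.
Qed.

(** * A longest path as a spine *)

Lemma spine_of_longest_path (P : seq T) : longest_path e P ->
    (forall x, exists2 y, y \in P & dist_le e 2 x y) ->
  exists L s f g, spine [set: T] L s f g.
Proof.
case=> /and3P[]; case: P => // x0 P0.
set P := x0 :: P0 => _ srtP uniqP maxP domP.
pose L := size P0; have szP : size P = L.+1 by [].
(* A choice of middle vertex for each [x] at distance 2 from [P]; both then get the same foot. The
   default 0 in [f] is never reached, by [fiber2]. *)
pose parent x := [pick y | [&& e x y, y \notin P & has (e y) P]].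
pose f x := if x \in P then index x P else if has (e x) P then find (e x) P
  else if parent x is Some y then find (e y) P else 0.
pose g x := if x \in P then 0 else if has (e x) P then 1 else 2.
pose s i := nth x0 P i.
have fiber1 x : x \notin P -> has (e x) P ->
    [/\ find (e x) P <= L, e x (s (find (e x) P)) & s (find (e x) P) \in P].
  move=> xP hx; have := hx; rewrite has_find szP => lt; split=> //.
    exact: (nth_find x0 hx).
  by rewrite mem_nth // szP.
have fiber2 x : x \notin P -> ~~ has (e x) P ->
    exists y, [/\ e x y, y \notin P, has (e y) P & f x = find (e y) P].
  move=> xP hx; rewrite /f (negbTE xP) (negbTE hx) /parent.
  case: pickP => [y /and3P[]|none].
    by exists y.
  have [y yP [p [xp py sp]]] := domP x.
  case: p xp py sp => [|z [|w [|? ?]]] //=.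
  - by move=> _ xy; rewrite xy yP in xP.
  - by rewrite andbT => exz zy _; case/hasP: hx; exists y; rewrite // -zy.
  - move=> /and3P[exz ezw _] wy _.
    have hz : has (e z) P by apply/hasP; exists y; rewrite // -wy.
    have zP : z \notin P by apply: contra hx => zP; apply/hasP; exists z.
    by have := none z; rewrite exz zP hz.
(* Putting the leg of [x] in front of a piece of [P] that starts at its foot [v] yields a simple
   path, which cannot outgrow [P]. *)
have short v Q : sorted e (v :: Q) -> uniq (v :: Q) -> {subset v :: Q <= P} ->
    forall x, (f x <= L /\ s (f x) = v) -> size (v :: Q) + g x <= L.+1.
  move=> srtQ uniqQ subQ x [fL sv].
  have vP : v \in P by apply: subQ; rewrite mem_head.
  have notQ y : y \notin P -> y \notin v :: Q by apply: contra; apply: subQ.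
  rewrite -szP; have [xP|xP] := boolP (x \in P).
    rewrite /g xP addn0; exact: uniq_leq_size.
  have [hx|hx] := boolP (has (e x) P).
    have gx : g x = 1 by rewrite /g (negbTE xP) hx.
    have fx : f x = find (e x) P by rewrite /f (negbTE xP) hx.
    rewrite gx addn1; apply: (maxP (x :: v :: Q)); apply/and3P; split=> //.
      by rewrite /= -sv fx; case: (fiber1 x xP hx) => _ -> _; rewrite -fx sv.
    by rewrite cons_uniq notQ.
  have gx : g x = 2 by rewrite /g (negbTE xP) (negbTE hx).
  have [y [exy yP hy fx]] := fiber2 x xP hx.
  rewrite gx addn2; apply: (maxP (x :: y :: v :: Q)); apply/and3P; split=> //.
    by rewrite /= exy -sv fx; case: (fiber1 y yP hy) => _ -> _; rewrite -fx sv.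
  rewrite cons_uniq inE negb_or notQ // andbT cons_uniq notQ // uniqQ !andbT.
  by apply/eqP => xy; rewrite xy hy in hx.
have fL x : f x <= L.
  have [xP|xP] := boolP (x \in P).
    by rewrite /f xP -ltnS -szP index_mem.
  have [hx|hx] := boolP (has (e x) P).
    by rewrite /f (negbTE xP) hx; case: (fiber1 x xP hx).
  by have [y [_ yP hy ->]] := fiber2 x xP hx; case: (fiber1 y yP hy).
exists L, s, f, g; split; first split.
- by move=> i _; rewrite inE.
- by move=> i iL; rewrite /f mem_nth ?szP // index_uniq ?szP.
- by move=> i iL; rewrite /g mem_nth ?szP.
- by move=> i iL; apply: (pathP x0 srtP).
- move=> x _; have := fL x => fxL.
  (* The initial segment, read backwards from the foot, gives the right bound. *)
  have E : rev (take (f x).+1 P) = s (f x) :: rev (take (f x) P).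
    by rewrite (take_nth x0) ?szP ?ltnS // rev_rcons.
  have := @short (s (f x)) (rev (take (f x) P)); rewrite -E => le.
  suff: size (rev (take (f x).+1 P)) + g x <= L.+1.
    by rewrite size_rev size_takel ?szP.
  apply: le => //; last by move=> z; rewrite mem_rev => /mem_take.
    have sym u v : e v u = e u v by rewrite sym_e.
    by rewrite rev_sorted (eq_sorted sym) take_sorted.
  by rewrite rev_uniq take_uniq.
- by move=> x _; rewrite /g; case: ifP => //; case: ifP.
- move=> x _; rewrite /g /f; case: ifP => [xP _|_]; last by case: ifP.
  by rewrite /s nth_index.
- move=> x _; rewrite /g /f; case: ifP => // xP; case: ifP => // hx _.
  by case: (fiber1 x (negbT xP) hx).
- move=> x _; rewrite {1}/g; case: ifP => // xP; case: ifP => // hx _.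
  have [y [exy yP hy fx]] := fiber2 x (negbT xP) (negbT hx).
  by exists y; rewrite fx /g /f (negbTE yP) hy inE.
- move=> x _; have := fL x => fxL.
  (* The final segment gives the left bound. *)
  have E : drop (f x) P = s (f x) :: drop (f x).+1 P.
    by rewrite (drop_nth x0) ?szP.
  have := @short (s (f x)) (drop (f x).+1 P); rewrite -E => le.
  suff: size (drop (f x) P) + g x <= L.+1 by rewrite size_drop szP; lia.
  apply: le => //; last by move=> z /mem_drop.
    exact: drop_sorted.
  exact: drop_uniq.
Qed.

End Spine.

(** * The radii [0, ..., k - 1] and the square root bound *)

Lemma sum_odd_iota k : \sum_(r <- rev (iota 0 k)) r.*2.+1 = k ^ 2.
Proof.
rewrite (perm_big (iota 0 k)) ?perm_rev //=; elim: k => [|k IHk].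
  by rewrite big_nil.
by rewrite -addn1 iotaD big_cat /= IHk big_seq1 add0n !expnS; lia.
Qed.

Lemma caterpillar2_burning_number (T : finType) (e : rel T) k :
  caterpillar e 2 -> #|T| <= k ^ 2 -> burning_number e <= k.
Proof.
case=> [[sym_e _ _ _] [P [maxP domP]]] card_T.
have [L [s [f [g H]]]] := spine_of_longest_path sym_e maxP domP.
apply: coverable_burning_number; apply: (coverable_spine sym_e _ H).
  rewrite rev_sorted; exact: iota_ltn_sorted.
by rewrite sum_odd_iota cardsT.
Qed.

Import Order.TTheory GRing.Theory Num.Theory.

Local Open Scope ring_scope.

Theorem mainTheorem4 (R : realType) (T : finType) (e : rel T)
    (cat2 : caterpillar e 2) :
  (burning_number e)%:Z <= Num.ceil (Num.sqrt (#|T|%:R : R)).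
Proof.
set z := Num.ceil _.
have z0 : 0 <= z.
  by rewrite ceil_ge0 (lt_le_trans _ (sqrtr_ge0 _)) // ltrN10.
have [k zk] : exists k : nat, z = k%:Z.
  by exists `|z|%N; rewrite gez0_abs.
rewrite zk lez_nat; apply: caterpillar2_burning_number cat2 _.
rewrite -(ler_nat R) natrX -[leLHS]sqr_sqrtr ?ler0n //.
rewrite lerXn2r ?nnegrE ?sqrtr_ge0 ?ler0n //.
by have := ceil_ge (Num.sqrt (#|T|%:R : R)); rewrite -/z zk.
Qed.
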